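(* Let $X$ be an arbitrary set and let $(A,\Omega,+,0)\in\mathcal{S}_{\mathcal{V}}^{0}$. Each mapping $h\colon X\to A$ can be extended to a unique homomorphism $\overline{\overline{h}}\colon(\mathcal{P}^{<\omega}F_{\mathcal{V}}(X),\Omega,\cup,\emptyset)\to(A,\Omega,+,0)$ such that $\overline{\overline{h}}|_X=h$, where each $x\in X$ is identified with the singleton $\{x\}$.
   Context: Fix a finitary type $\tau\colon\Omega\to\mathbb{N}^+$ (all operations have positive arity; $\Omega$ may be infinite), and let $\mathcal{V}$ be a variety of algebras of type $\tau$. $(F_{\mathcal{V}}(X),\Omega)$ is the free algebra over $X$ in $\mathcal{V}$ (there are no constants, so it is empty if $X=\emptyset$). A semilattice ordered $\mathcal{V}$-algebra is an algebra $(A,\Omega,+)$ with $(A,\Omega)\in\mathcal{V}$, $(A,+)$ a (join) semilattice, and each $\omega\in\Omega$ distributing over $+$ in each argument: $\omega(x_1,\ldots,x_i+y_i,\ldots,x_n)=\omega(x_1,\ldots,x_i,\ldots,x_n)+\omega(x_1,\ldots,y_i,\ldots,x_n)$. A $0$-semilattice ordered $\mathcal{V}$-algebra $(A,\Omega,+,0)$ is a semilattice ordered $\mathcal{V}$-algebra $(A,\Omega,+)$ in which $0$ is the least element of the semilattice (with order $x\le y\Leftrightarrow x+y=y$) and $\omega(x_1,\ldots,x_n)=0$ for each $\omega\in\Omega$ whenever some $x_i=0$. $\mathcal{S}^0_{\mathcal{V}}$ is the variety of all $0$-semilattice ordered $\mathcal{V}$-algebras. $\mathcal{P}^{<\omega}B$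 is the set of all finite subsets of $B$ (including $\emptyset$), with complex operations $\omega(B_1,\ldots,B_n)=\{\omega(b_1,\ldots,b_n)\mid b_i\in B_i\}$ (which is $\emptyset$ if some $B_i=\emptyset$) and set union $\cup$. *)

(* Defs.v *)
From mathcomp Require Import all_boot.
From mathcomp Require Import boolp classical_sets cardinality.

Set Implicit Arguments.
Unset Strict Implicit.
Unset Printing Implicit Defensive.

Local Open Scope classical_set_scope.

(* A type is a map tau : Omega -> nat giving the arities; the tuple of
   arguments of w is a function 'I_(tau w) -> A.  Carriers may be empty. *)
Record algebra (Omega : Type) (tau : Omega -> nat) := Algebra {
  carrier :> Type;
  op : forall w : Omega, ('I_(tau w) -> carrier) -> carrier }.

Arguments Algebra {Omega tau carrier} op.
Arguments op {Omega tau} a w _.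

Definition is_hom (Omega : Type) (tau : Omega -> nat) (A B : algebra tau)
    (f : A -> B) : Prop :=
  forall (w : Omega) (a : 'I_(tau w) -> A), f (op A w a) = op B w (f \o a).

Inductive term (Omega : Type) (tau : Omega -> nat) (X : Type) : Type :=
| Var (x : X)
| App (w : Omega) (args : 'I_(tau w) -> term tau X).

Fixpoint eval (Omega : Type) (tau : Omega -> nat) (X : Type) (A : algebra tau)
    (v : X -> A) (t : term tau X) : A :=
  match t with
  | Var x => v x
  | App w args => op A w (fun i => eval v (args i))
  end.

Definition satisfies (Omega : Type) (tau : Omega -> nat) (A : algebra tau)
    (s t : term tau nat) : Prop :=
  forall v : nat -> A, eval v s = eval v t.

(* V is the class of all algebras satisfying some set of identities E. *)
Definition is_variety (Omega : Type) (tau : Omega -> nat)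
    (V : algebra tau -> Prop) : Prop :=
  exists E : set (term tau nat * term tau nat),
    forall A : algebra tau,
      V A <-> (forall s t, E (s, t) -> satisfies A s t).

(* eta need not be injective: it is not when V is trivial and X has at least
   two elements. *)
Definition is_free (Omega : Type) (tau : Omega -> nat)
    (V : algebra tau -> Prop) (X : Type) (F : algebra tau) (eta : X -> F) :
    Prop :=
  V F /\
  forall (B : algebra tau) (f : X -> B), V B ->
    exists! g : F -> B, is_hom g /\ (forall x, g (eta x) = f x).

Record algebra0 (Omega : Type) (tau : Omega -> nat) := Algebra0 {
  reduct :> algebra tau;
  join : reduct -> reduct -> reduct;
  zero : reduct }.

Arguments Algebra0 {Omega tau reduct} join zero.
Arguments join {Omega tau} a _ _.
Arguments zero {Omega tau} a.

Definition is_hom0 (Omega : Type) (tau : Omega -> nat) (A B : algebra0 tau)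
    (f : A -> B) : Prop :=
  [/\ is_hom f,
      forall x y, f (join A x y) = join B (f x) (f y)
    & f (zero A) = zero B].

Definition is_semilattice (T : Type) (add : T -> T -> T) : Prop :=
  [/\ associative add, commutative add & idempotent_op add].

Definition join_le (T : Type) (add : T -> T -> T) (x y : T) : Prop :=
  add x y = y.

(* [eta a with i |-> x] is the tuple a with its i-th entry replaced by x. *)
Definition ops_distribute (Omega : Type) (tau : Omega -> nat)
    (A : algebra tau) (add : A -> A -> A) : Prop :=
  forall (w : Omega) (a : 'I_(tau w) -> A) (i : 'I_(tau w)) (x y : A),
    op A w [eta a with i |-> add x y] =
    add (op A w [eta a with i |-> x]) (op A w [eta a with i |-> y]).

Definition is_slo (Omega : Type) (tau : Omega -> nat)
    (V : algebra tau -> Prop) (A : algebra tau) (add : A -> A -> A) : Prop :=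
  [/\ V A, is_semilattice add & ops_distribute add].

(* Membership in the class S^0_V. *)
Definition is_slo0 (Omega : Type) (tau : Omega -> nat)
    (V : algebra tau -> Prop) (A : algebra0 tau) : Prop :=
  [/\ is_slo V (join A),
      forall x : A, join_le (join A) (zero A) x
    & forall (w : Omega) (a : 'I_(tau w) -> A),
        (exists i, a i = zero A) -> op A w a = zero A].

Definition finite_subset (T : Type) : Type := {S : set T | finite_set S}.

Definition complex_op (Omega : Type) (tau : Omega -> nat) (B : algebra tau)
    (w : Omega) (S : 'I_(tau w) -> set B) : set B :=
  [set op B w b | b in [set b | forall i, S i (b i)]].

Lemma finite_pi (n : nat) (T : Type) (S : 'I_n -> set T) :
  (forall i, finite_set (S i)) ->
  finite_set [set b : 'I_n -> T | forall i, S i (b i)].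
Proof.
move=> finS.
have /choice[s sE] i : exists s : seq {classic T}, S i = [set` s].
  by apply/(@finite_seqP {classic T})/finS.
pose val_at (f : {dffun forall i, 'I_(size (s i))}) (i : 'I_n) : T :=
  tnth (in_tuple (s i)) (f i).
have := finite_image val_at (@finite_finset _ setT).
apply: sub_finite_set => b /= Sb.
have idx i : exists k : 'I_(size (s i)), tnth (in_tuple (s i)) k = b i.
  have := Sb i; rewrite sE /= => bi.
  by have /tnthP[k ->] : (b i : {classic T}) \in in_tuple (s i) by []; exists k.
pose f i := sval (cid (idx i)).
exists [ffun i => f i] => //; apply/funext => i.
by rewrite /val_at ffunE /f; case: cid.
Qed.

Lemma finite_complex_op (Omega : Type) (tau : Omega -> nat) (B : algebra tau)
    (w : Omega) (S : 'I_(tau w) -> finite_subset B) :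
  finite_set (complex_op (fun i => sval (S i))).
Proof.
apply: finite_image; apply: (finite_pi (S := fun i => sval (S i))) => i.
exact: svalP.
Qed.

Lemma finite_union (T : Type) (S S' : finite_subset T) :
  finite_set (sval S `|` sval S').
Proof. by rewrite finite_setU; split; exact: svalP. Qed.

Definition fin_union (T : Type) (S S' : finite_subset T) : finite_subset T :=
  exist _ (sval S `|` sval S') (finite_union S S').

Definition fin_empty (T : Type) : finite_subset T :=
  exist _ set0 (finite_set0 T).

Definition fin_singleton (T : Type) (x : T) : finite_subset T :=
  exist _ [set x] (finite_set1 x).

Definition power_algebra (Omega : Type) (tau : Omega -> nat)
    (B : algebra tau) : algebra tau :=
  @Algebra _ tau (finite_subset B)
    (fun w S => exist _ (complex_op (fun i => sval (S i)))
                        (finite_complex_op S)).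

Definition power_algebra0 (Omega : Type) (tau : Omega -> nat)
    (B : algebra tau) : algebra0 tau :=
  @Algebra0 _ tau (power_algebra B) (@fin_union B) (fin_empty B).

(* Main.v *)
From mathcomp Require Import all_boot.
From mathcomp Require Import boolp classical_sets cardinality.
Require Import Defs.

Set Implicit Arguments.
Unset Strict Implicit.
Unset Printing Implicit Defensive.

(** Let [g : F -> A] be the homomorphism extending [h], given by freeness.  A
finite subset [S] of [F] is the union of its singletons, that is, their join in
the semilattice of finite subsets, so an extension has no choice but to send
[S] to the join of [g @` S] in [A]; as [A] has a least element, this join
exists even for the empty set.

The map so defined turns unions into joins for order-theoretic reasons.  It
commutes with the operations because an operation of [A], distributing over
[+] and absorbing [0] in each argument, preserves finite joins in each argument
([op_is_join1]), hence in all arguments simultaneously ([op_is_join]):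
[op w] applied to the joins of the [S i] is the join of the complex product of
the [S i].

Conversely, let [k] be a homomorphism extending [h].  On singletons it is a
homomorphism [F -> A] extending [h] ([fin_singleton_hom]), hence it is [g]
there.  As [k] preserves finite joins ([is_join_morph]), [k S] is the join of
[g @` S]. *)

Local Open Scope classical_set_scope.

Lemma finite_set_induction (T : Type) (P : set T -> Prop) :
  P set0 -> (forall x S, P S -> P (x |` S)) -> forall S, finite_set S -> P S.
Proof.
move=> P0 PU S /(@finite_seqP {classic T})[s ->].
elim: s => [|x s IHs].
  by have -> : [set` [::]] = set0 :> set {classic T} by apply/seteqP; split.
have -> : [set` x :: s] = x |` [set` s] :> set {classic T}.
  by apply/predeqP => y /=; rewrite inE; split=> [/predU1P|/predU1P].
exact: PU.
Qed.

(** Stating leastness as an equivalence makes joins of joins, and joins in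
several arguments, a matter of chaining equivalences. *)
Definition is_join (T : Type) (add : T -> T -> T) (S : set T) (a : T) : Prop :=
  forall c, join_le add a c <-> forall s, S s -> join_le add s c.

(** * Joins of finite sets in a semilattice with a least element *)

Section FiniteJoins.
Context (T : Type) (add : T -> T -> T) (o : T).
Hypotheses (semi : is_semilattice add) (o_least : forall x, join_le add o x).

Lemma join_le_refl x : join_le add x x.
Proof. by case: semi => _ _; apply. Qed.

Lemma join_le_anti x y : join_le add x y -> join_le add y x -> x = y.
Proof. by case: semi => _ addC _ xy yx; rewrite -xy addC. Qed.

Lemma join_le_add x y c :
  join_le add (add x y) c <-> join_le add x c /\ join_le add y c.
Proof.
case: semi => addA addC addI; rewrite /join_le; split=> [<-|[xc yc]].
  by split; rewrite !addA ?addI // (addC y x) -(addA x) addI.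
by rewrite -addA yc.
Qed.

Lemma is_join_unique S a b : is_join add S a -> is_join add S b -> a = b.
Proof.
move=> Sa Sb; apply: join_le_anti.
  exact/Sa/Sb/join_le_refl.
exact/Sb/Sa/join_le_refl.
Qed.

Lemma is_join0 : is_join add set0 o.
Proof. by move=> c; split. Qed.

Lemma is_join1 x : is_join add [set x] x.
Proof. by move=> c; split=> [xc s ->//|]; apply. Qed.

Lemma is_joinU S S' a a' :
  is_join add S a -> is_join add S' a' -> is_join add (S `|` S') (add a a').
Proof.
move=> Sa S'a' c; split=> [/join_le_add[/Sa ac /S'a' a'c] s []|SS'c].
- exact: ac.
- exact: a'c.
by apply/join_le_add; split; [apply/Sa|apply/S'a'] => s Ss; apply: SS'c;
  [left|right].
Qed.

Lemma finite_is_join S : finite_set S -> exists a, is_join add S a.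
Proof.
move: S; apply: finite_set_induction; first by exists o; exact: is_join0.
move=> x S [a Sa]; exists (add x a).
by apply: is_joinU => //; exact: is_join1.
Qed.

End FiniteJoins.

(** By induction on the finite set, its join is built from the least element
and binary joins, which a morphism preserves; uniqueness of joins carries this
over to the given [a]. *)
Lemma is_join_morph (T U : Type) (add : T -> T -> T) (o : T)
    (add' : U -> U -> U) (o' : U) (f : T -> U) :
  is_semilattice add -> (forall x, join_le add o x) ->
  is_semilattice add' -> (forall x, join_le add' o' x) ->
  (forall x y, f (add x y) = add' (f x) (f y)) -> f o = o' ->
  forall S a, finite_set S -> is_join add S a -> is_join add' (f @` S) (f a).
Proof.
move=> semi o_least semi' o'_least fD f0 S a finS Sa.
suff [b [Sb fSb]] : exists b, is_join add S b /\ is_join add' (f @` S) (f b).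
  by rewrite (is_join_unique semi Sa Sb).
move: S finS {a Sa}; apply: finite_set_induction.
  by exists o; rewrite image_set0 f0; split; exact: is_join0.
move=> x S [b [Sb fSb]]; exists (add x b).
rewrite image_setU image_set1 fD.
by split; apply: is_joinU => //; exact: is_join1.
Qed.

(** * Operations of a 0-semilattice ordered algebra preserve finite joins *)

Section OperationJoins.
Context (Omega : Type) (tau : Omega -> nat) (V : algebra tau -> Prop).
Context (A : algebra0 tau) (A_slo0 : is_slo0 V A).

Let A_semi : is_semilattice (join A). Proof. by case: A_slo0 => [[]]. Qed.
Let zero_least x : join_le (join A) (zero A) x. Proof. by case: A_slo0. Qed.

Lemma op_is_join1 (w : Omega) (a : 'I_(tau w) -> A) (i : 'I_(tau w))
    (S : set A) (s : A) :
  finite_set S -> is_join (join A) S s ->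
  is_join (join A) [set op A w [eta a with i |-> x] | x in S]
          (op A w [eta a with i |-> s]).
Proof.
case: A_slo0 => [[_ _ opD] _ op0].
apply: (is_join_morph (f := fun x => op A w [eta a with i |-> x])
          A_semi zero_least A_semi zero_least) => [x y|].
  exact: opD.
by apply: op0; exists i; rewrite /= eqxx.
Qed.

(** The arguments listed in [r] run over the sets [S i], the others stay put;
lengthening [r] by one index is one application of [op_is_join1]. *)
Lemma op_join_le_on (w : Omega) (S : 'I_(tau w) -> set A) (a : 'I_(tau w) -> A)
    (c : A) (r : seq 'I_(tau w)) :
  (forall i, finite_set (S i)) -> (forall i, is_join (join A) (S i) (a i)) ->
  uniq r ->
  join_le (join A) (op A w a) c <->
  forall b, (forall i, if i \in r then S i (b i) else b i = a i) ->
    join_le (join A) (op A w b) c.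
Proof.
move=> finS Sa; elim: r => [_|j r IHr /= /andP[jr /IHr{}IHr]].
  split=> [ac b ba|]; last by apply.
  by rewrite (_ : b = a) //; apply/funext.
split=> [/IHr{}IHr b Sb|Sc].
  (* Put [a j] back at [j] to use the induction hypothesis; [op w b] is then
     one of the elements joined at argument [j]. *)
  have bc : join_le (join A) (op A w [eta b with j |-> a j]) c.
    apply: IHr => i /=; have := Sb i; rewrite inE.
    by case: eqP => [->|//]; rewrite (negbTE jr).
  apply: (proj1 (op_is_join1 b j (finS j) (Sa j) c) bc).
  exists (b j); first by have := Sb j; rewrite mem_head.
  by congr (op A w _); apply/funext => i /=; case: eqP => [->|].
apply/IHr => b Sb.
have -> : b = [eta b with j |-> a j].
  apply/funext => i /=; case: eqP => [->|//].
  by have := Sb j; rewrite (negbTE jr).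
apply/(op_is_join1 b j (finS j) (Sa j) c) => _ [x Sx <-].
apply: Sc => i /=; rewrite inE; case: eqP => [->//|_].
exact: Sb.
Qed.

Lemma op_is_join (w : Omega) (S : 'I_(tau w) -> set A) (a : 'I_(tau w) -> A) :
  (forall i, finite_set (S i)) -> (forall i, is_join (join A) (S i) (a i)) ->
  is_join (join A) (complex_op S) (op A w a).
Proof.
move=> finS Sa c.
have [le1 le2] := op_join_le_on c finS Sa (enum_uniq 'I_(tau w)).
split=> [/le1 Sc _ [b Sb <-]|Sc].
  by apply: Sc => i; rewrite mem_enum; exact: Sb.
apply: le2 => b Sb; apply: Sc; exists b => // i.
by have := Sb i; rewrite mem_enum.
Qed.

End OperationJoins.

(** * The algebra of finite subsets *)

Section FiniteSubsets.
Context (Omega : Type) (tau : Omega -> nat) (B : algebra tau).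

Lemma finite_subset_inj (T : Type) (S S' : finite_subset T) :
  sval S = sval S' -> S = S'.
Proof. by case: S S' => [S finS] [S' finS'] /= SS'; apply/eq_exist. Qed.

Lemma fin_union_semilattice (T : Type) : is_semilattice (@fin_union T).
Proof.
split=> [S1 S2 S3|S1 S2|S1]; apply: finite_subset_inj.
- exact: setUA.
- exact: setUC.
- exact: setUid.
Qed.

Lemma fin_empty_least (T : Type) (S : finite_subset T) :
  join_le (@fin_union T) (fin_empty T) S.
Proof. by apply: finite_subset_inj; exact: set0U. Qed.

Lemma join_le_fin_union (T : Type) (S S' : finite_subset T) :
  join_le (@fin_union T) S S' <-> sval S `<=` sval S'.
Proof.
split=> [<- x|/setUidPr SS']; first by left.
exact: finite_subset_inj.
Qed.

Lemma is_join_singletons (T : Type) (S : finite_subset T) :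
  is_join (@fin_union T) (@fin_singleton T @` sval S) S.
Proof.
move=> S'; rewrite join_le_fin_union; split=> [SS' _ [x Sx <-]|SS' x Sx].
  by apply/join_le_fin_union => _ ->; exact: SS'.
by have /join_le_fin_union := SS' _ (imageP _ Sx); apply.
Qed.

Lemma fin_singleton_hom : is_hom (fun x : B => fin_singleton x : power_algebra B).
Proof.
move=> w b; apply: finite_subset_inj; apply/seteqP; split=> [_ ->|_ [c cb <-]].
  by exists b.
by rewrite (_ : c = b) //; apply/funext.
Qed.

Lemma image_complex_op (C : algebra tau) (g : B -> C) (w : Omega)
    (S : 'I_(tau w) -> set B) :
  is_hom g -> g @` complex_op S = complex_op (fun i => g @` S i).
Proof.
move=> g_hom; apply/seteqP; split=> [_ [_ [b Sb <-] <-]|_ [c Sc <-]].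
  by rewrite g_hom; exists (g \o b) => // i; exists (b i); first exact: Sb.
have /choice[b Sb] i : exists x, S i x /\ g x = c i.
  by have [x Sx gx] := Sc i; exists x.
exists (op B w b); first by exists b => // i; exact: (Sb i).1.
by rewrite g_hom; congr (op C w _); apply/funext => i; exact: (Sb i).2.
Qed.

End FiniteSubsets.

Theorem corollary4p2
  (Omega : Type) (tau : Omega -> nat) (tau_gt0 : forall w : Omega, 0 < tau w)
  (V : algebra tau -> Prop) (V_variety : is_variety V)
  (X : Type) (F : algebra tau) (eta : X -> F) (F_free : is_free V eta)
  (A : algebra0 tau) (A_slo0 : is_slo0 V A) (h : X -> A) :
  exists! hbar : power_algebra0 F -> A,
    is_hom0 hbar /\ (forall x : X, hbar (fin_singleton (eta x)) = h x).
Proof.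
have [[VA A_semi _] zero_least _] := A_slo0.
have [g [[g_hom gh] g_unique]] := F_free.2 A h VA.
have finite_img (S : finite_subset F) : finite_set (g @` sval S).
  exact/finite_image/svalP.
have /choice[hbar hbar_join] (S : finite_subset F) :
    exists a, is_join (join A) (g @` sval S) a.
  exact: finite_is_join A_semi zero_least _ (finite_img S).
have hbarE S a : is_join (join A) (g @` sval S) a -> hbar S = a.
  exact: is_join_unique.
exists hbar; split.
  split=> [|x]; last by apply: hbarE; rewrite image_set1 gh; exact: is_join1.
  split=> [w S|S S'|].
  - apply: hbarE; rewrite /= image_complex_op //.
    by apply: (op_is_join A_slo0) => i; [exact: finite_img|exact: hbar_join].
  - by apply: hbarE; rewrite /= image_setU; exact: is_joinU.
  - by apply: hbarE; rewrite /= image_set0; exact: is_join0.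
move=> k [[k_hom kU k0] kh]; apply/funext => S; apply: hbarE.
have gE : g = k \o (@fin_singleton F).
  apply: g_unique; split=> // w b /=.
  by rewrite (fin_singleton_hom b) k_hom.
rewrite gE -image_comp.
apply: (is_join_morph (@fin_union_semilattice F) (@fin_empty_least F)
          A_semi zero_least kU k0); last exact: is_join_singletons.
exact/finite_image/svalP.
Qed.
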